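(* Let $\varphi\in(0,\pi]$, $c,d\geq0$ and $\alpha=e^{i\varphi}$. If $\cos\varphi=-1$, or $\cos\varphi$ does not belong to the set of dyadic rationals $\{a/2^b:a,b\in\mathbb{Z},\,b\ge0\}$, then the Lévy measure $c\delta_\alpha+d\delta_{\bar\alpha}$ is L-unique.
   Context: A Lévy measure on $\mathbb{T}$ is a positive Borel measure $\rho$ with $\rho(\{1\})=0$ and $1-\Re s\in L^1(\rho)$. For a Lévy measure $\rho$, $\nu_\circledast^{(1,0,\rho)}$ is the probability measure on $\mathbb{T}$ with $\int s^n\,d\nu=\exp\big(\int_{\mathbb{T}}(s^n-1-in\Im s)\,d\rho(s)\big)$ for $n\in\mathbb{Z}$. $\mathcal{L}(\rho)$ is the set of Lévy measures $\widetilde\rho$ with $\nu_\circledast^{(1,0,\widetilde\rho)}=\nu_\circledast^{(1,0,\rho)}$, and $\rho$ is called L-unique if $\mathcal{L}(\rho)=\{\rho\}$. *)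

(* Defs.v *)
From HB Require Import structures.
From mathcomp Require Import all_boot all_order all_algebra.
From mathcomp Require Import all_classical all_reals all_analysis.
From mathcomp.real_closed Require Import complex.
Set Implicit Arguments. Unset Strict Implicit. Unset Printing Implicit Defensive.
Import Order.TTheory GRing.Theory Num.Theory.
Local Open Scope ring_scope.
Local Open Scope classical_set_scope.
Local Open Scope complex_scope.

(* The complex plane is modelled as the measurable space R * R (product
   sigma-algebra = Borel sigma-algebra of R^2); a point s = (x, y)
   corresponds to the complex number x + i y. *)

Definition toC (R : realType) (s : R * R) : R[i] := s.1 +i* s.2.

Definition torus (R : realType) : set (R * R) :=
  [set s | s.1 ^+ 2 + s.2 ^+ 2 = 1].

Definition expC (R : realType) (z : R[i]) : R[i] :=
  (expR (complex.Re z))%:C * (cos (complex.Im z) +i* sin (complex.Im z)).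

(* A (positive Borel) measure on T is a measure on the plane concentrated
   on T.  Levy measure: rho({1}) = 0 and 1 - Re s in L^1(rho). *)
Definition is_levy (R : realType) (rho : {measure set (R * R)%type -> \bar R}) : Prop :=
  [/\ rho (~` @torus R) = 0%E,
      rho [set (1, 0)] = 0%E &
      rho.-integrable (@torus R) (fun s => (1 - s.1)%:E)].

Definition levy_integrand (R : realType) (n : int) (s : R * R) : R[i] :=
  toC s ^ n - 1 - 'i * (n%:~R * s.2)%:C.

Definition levy_exponent (R : realType) (rho : {measure set (R * R)%type -> \bar R})
  (n : int) : R[i] :=
  Rintegral rho (@torus R) (fun s => complex.Re (levy_integrand n s)) +i*
  Rintegral rho (@torus R) (fun s => complex.Im (levy_integrand n s)).

(* n-th Fourier coefficient of nu_circledast^{(1,0,rho)}: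
   \int s^n d nu = exp (\int (s^n - 1 - i n Im s) d rho). *)
Definition levy_fourier (R : realType) (rho : {measure set (R * R)%type -> \bar R})
  (n : int) : R[i] := expC (levy_exponent rho n).

(* L(rho): Levy measures rt with nu^{(1,0,rt)} = nu^{(1,0,rho)}, i.e. with the
   same Fourier coefficients (a probability measure on T is determined by its
   Fourier coefficients). *)
Definition levy_class (R : realType) (rho : {measure set (R * R)%type -> \bar R})
  : set {measure set (R * R)%type -> \bar R} :=
  [set rt | is_levy rt /\ forall n : int, levy_fourier rt n = levy_fourier rho n].

Definition L_unique (R : realType) (rho : {measure set (R * R)%type -> \bar R}) : Prop :=
  is_levy rho /\
  forall rt, levy_class rho rt -> forall A, measurable A -> rt A = rho A.

(* Main.v *)
(* Only the Fourier coefficients n = 1, 2, 3 are needed to locate the support: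
   their moduli give the integrals of Re s^n - 1, hence that of
   (Re s - cos phi)^2 (1 - Re s), a nonnegative function that vanishes on the
   circle only at alpha, its conjugate and 1.  So a measure in the class is
   c' delta_alpha + d' delta_(conj alpha), and n = 1 gives c' + d' = c + d.  The
   arguments say that K (sin (n phi) - n sin phi) is an integer for all n, with
   2 pi K = (c' - d') - (c - d).  If K is nonzero, this lattice condition forces
   g (2 cos phi)^m to be an integer for all m and some nonzero integer g, so the
   rational number 2 cos phi is an integer and cos phi is dyadic. *)
Require Import Defs.
From HB Require Import structures.
From mathcomp Require Import all_boot all_order all_algebra.
From mathcomp Require Import all_classical all_reals all_analysis.
From mathcomp.real_closed Require Import complex.
From mathcomp Require Import measurable_realfun ring lra.
Import Order.TTheory GRing.Theory Num.Theory.
Local Open Scope ring_scope.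
Local Open Scope classical_set_scope.

(** * Arithmetic: integrality from bounded denominators of powers *)

(** The cases [m = 0] and [m = 1] make [y] a quotient of integers. In lowest terms, every power of
    its denominator divides the nonzero integer [g], so the denominator is 1. *)
Lemma int_of_int_mul_exp (R : archiRealFieldType) (g y : R) :
  g != 0 -> (forall m, g * y ^+ m \is a Num.int) -> y \is a Num.int.
Proof.
move=> g0 gyint.
have /intrP[gz gE] : g \is a Num.int by have := gyint 0%N; rewrite expr0 mulr1.
have /intrP[hz hE] : g * y \is a Num.int by have := gyint 1%N; rewrite expr1.
pose q : rat := hz%:~R / gz%:~R.
have gz0 : gz != 0 by rewrite -(intr_eq0 R) -gE.
have yE : y = ratr q.
  by rewrite /q fmorph_div /= !ratr_int -hE -gE mulrC mulKf.
have dvdn_pow m : (`|denq q| ^ m %| `|gz|)%N.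
  have /intrP[k kE] := gyint m.
  have : (gz * numq q ^+ m = k * denq q ^+ m)%R.
    apply/eqP; rewrite -(eqr_int rat) !rmorphM /= !rmorphXn /=.
    rewrite {1}numqE exprMn mulrA; apply/eqP; congr (_ * _).
    apply: (fmorph_inj (ratr : {rmorphism rat -> R})).
    by rewrite rmorphM rmorphXn /= !ratr_int -gE -yE.
  move=> /(congr1 absz); rewrite !abszM !abszX => e.
  rewrite -(@Gauss_dvdl _ _ (`|numq q| ^ m)) ?e ?dvdn_mull//.
  by rewrite coprimeXl// coprimeXr// coprime_sym coprime_num_den.
have gz0' : (0 < `|gz|)%N by rewrite absz_gt0.
have denq1 : `|denq q|%N = 1%N.
  apply/eqP; rewrite eqn_leq absz_gt0 denq_neq0 andbT leqNgt; apply/negP => d1.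
  (* The exponent [|g|] suffices: a denominator at least 2 would have its [|g|]-th power at least
     2^|g| > |g|. *)
  have := dvdn_leq gz0' (dvdn_pow `|gz|%N); rewrite leqNgt.
  by rewrite (leq_trans (ltn_expl `|gz|%N (isT : 1 < 2)%N)) ?leq_exp2r.
have denqZ : denq q = 1 by rewrite -[LHS]gtz0_abs ?denq_gt0// denq1.
by rewrite yE -(divq_num_den q) denqZ divr1 ratr_int intr_int.
Qed.

(** * Trigonometry: periods, de Moivre's formula and the sine lattice *)

Section trigonometry.
Variable R : realType.

Lemma cos_eq1 (z : R) : cos z = 1 -> exists k : int, z = pi *+ 2 * k%:~R.
Proof.
move=> cz; have p0 := pi_gt0 R.
pose k := Num.floor (z / (pi *+ 2)); exists k.
have tp0 : 0 < pi *+ 2 :> R by rewrite mulrn_wgt0.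
have /andP[k1 k2] := floor_itv (z / (pi *+ 2)).
rewrite -/k in k1 k2.
rewrite ler_pdivlMr// in k1; rewrite ltr_pdivrMr// intrD mulrDl mul1r in k2.
have cosDk (m : nat) (x : R) : cos (x + pi *+ 2 * m%:R) = cos x.
  by rewrite mulr_natr (periodicn (@cosD2pi R)).
have czk : cos (z - pi *+ 2 * k%:~R) = 1.
  case: (intP k) => [|m|m]; first by rewrite mulr0 subr0.
    by rewrite -[LHS](cosDk m.+1) subrK.
  by rewrite intrN mulrN opprK cosDk.
set w := z - _ in czk.
have zE : z = w + pi *+ 2 * k%:~R by rewrite subrK.
suff w0 : w = 0 by rewrite zE w0 add0r.
have [w0 w2p] : 0 <= w /\ w < pi *+ 2 by rewrite /w; split; lra.
have [wp|wp] := leP w pi.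
  by apply: cos_inj; rewrite ?in_itv/= ?lexx ?w0 ?wp ?ltW// cos0.
(* For w > pi, reflection brings the angle into [0, pi], where cosine is injective; this would give
   w = 2 pi, which is excluded. *)
have : cos (pi *+ 2 - w) = cos 0 by rewrite addrC cosD2pi cosN cos0.
move=> /cos_inj.
rewrite !in_itv/= => h.
suff : pi *+ 2 - w = 0 by lra.
by apply: h; lra.
Qed.

Lemma cos_sin_eq (x y : R) : cos x = cos y -> sin x = sin y ->
  exists k : int, x - y = pi *+ 2 * k%:~R.
Proof.
by move=> cxy sxy; apply: cos_eq1; rewrite cosB cxy sxy -!expr2 cos2Dsin2.
Qed.

Lemma toC_cos_sin (x : R) (n : nat) :
  toC (cos x, sin x) ^ n%:Z = (cos (n%:R * x) +i* sin (n%:R * x))%C.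
Proof.
rewrite -exprnP; elim: n => [|n IH]; first by rewrite expr0 mul0r cos0 sin0.
rewrite exprS IH -nat1r mulrDl mul1r cosD sinD /toC/=.
by apply/eqP; rewrite eq_complex/= eqxx/= addrC mulrC [X in _ + X]mulrC eqxx.
Qed.

(* The second difference in [n] turns the hypothesis into
   [b sin (n x)] being an integer with [b = K (2 cos x - 2)], and
   [2 cos x * sin (n x) = sin ((n + 1) x) + sin ((n - 1) x)] propagates
   integrality to [b (2 cos x)^m sin (n x)]. *)
Lemma sin_lattice_int (K x : R) : K != 0 -> sin x != 0 ->
  (forall n : nat, K * (sin (n%:R * x) - n%:R * sin x) \is a Num.int) ->
  2 * cos x \is a Num.int.
Proof.
move=> K0 sx0 Kint.
pose b := K * (2 * cos x - 2).
have sinS n : sin (n.+2%:R * x) = 2 * cos x * sin (n.+1%:R * x) - sin (n%:R * x).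
  have -> : n.+2%:R * x = n.+1%:R * x + x by rewrite -natr1 mulrDl mul1r.
  have -> : n%:R * x = n.+1%:R * x - x by rewrite -natr1 mulrDl mul1r addrK.
  by rewrite sinD sinB; ring.
have bint n : b * sin (n%:R * x) \is a Num.int.
  case: n => [|n]; first by rewrite mul0r sin0 mulr0 rpred0.
  have -> : b * sin (n.+1%:R * x) =
      K * (sin (n.+2%:R * x) - n.+2%:R * sin x)
    + K * (sin (n%:R * x) - n%:R * sin x)
    - 2%:R * (K * (sin (n.+1%:R * x) - n.+1%:R * sin x)).
    by rewrite sinS /b -!natr1; ring.
  by rewrite rpredB ?rpredD// rpredM// natr_int.
have bmint m : forall n, b * (2 * cos x) ^+ m * sin (n%:R * x) \is a Num.int.
  elim: m => [|m IH] [|n]; rewrite ?mul0r ?sin0 ?mulr0 ?rpred0//.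
    by rewrite expr0 mulr1.
  have -> : b * (2 * cos x) ^+ m.+1 * sin (n.+1%:R * x) =
      b * (2 * cos x) ^+ m * sin (n.+2%:R * x)
    + b * (2 * cos x) ^+ m * sin (n%:R * x).
    by rewrite sinS exprS; ring.
  by rewrite rpredD.
apply: (@int_of_int_mul_exp _ (b * sin x)).
  (* The factor [2 * cos x - 2] of [b] vanishes only if cos x = 1, which contradicts sin x != 0. *)
  rewrite !mulf_neq0// subr_eq0; apply/eqP => c1.
  have {}c1 : cos x = 1 by lra.
  by move/eqP: sx0; apply; apply: cos1sin0; rewrite c1 normr1.
by move=> m; have := bmint m 1%N; rewrite mul1r mulrAC.
Qed.

End trigonometry.

(** * Integration against a measure carried by two points *)

Section atomic_measure.
Context d (T : measurableType d) (R : realType).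
Variables (mu : {measure set T -> \bar R}) (D : set T) (p q : T).
Hypotheses (mD : measurable D) (mp : measurable [set p])
  (mq : measurable [set q]).
Hypotheses (Dp : D p) (Dq : D q).
Hypotheses (mup : (mu [set p] < +oo)%E) (muq : (mu [set q] < +oo)%E).
Hypothesis muD : mu (D `\` [set p; q]) = 0%E.

Let mpq : measurable [set p; q]. Proof. exact: measurableU. Qed.

Let mN : measurable (D `\` [set p; q]). Proof. exact: measurableD. Qed.

Let setDN : D `\` (D `\` [set p; q]) = [set p; q].
Proof.
rewrite setDD; apply/setIidPr => x [->|->]; [exact: Dp | exact: Dq].
Qed.

(** Off a null set [f] takes at most two values, so it is dominated by the constant |f p| + |f q| on
    a set of finite mass. *)
Lemma atomic_integrable (f : T -> R) :
  measurable_fun D f -> mu.-integrable D (EFin \o f).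
Proof.
move=> mf; have mEf : measurable_fun D (EFin \o f) by exact/measurable_EFinP.
apply/(negligible_integrable mN mD mEf muD); rewrite setDN.
apply: (@le_integrable _ _ _ _ _ mpq _ (cst (`|f p| + `|f q|)%:E)).
- by apply: measurable_funS mEf => // x [->|->].
- move=> x /= [->|->]; rewrite lee_fin [leRHS]ger0_norm ?addr_ge0//.
    by rewrite lerDl.
  by rewrite lerDr.
- apply/integrableP; split; first exact: measurable_cst.
  rewrite integral_cst//= lte_mul_pinfty//.
  apply: (le_lt_trans (measureU2 _ _ _)) => //.
  exact: lte_add_pinfty.
Qed.

Lemma atomic_Rintegral (f : T -> R) : p <> q -> measurable_fun D f ->
  Rintegral mu D f = f p * fine (mu [set p]) + f q * fine (mu [set q]).
Proof.
move=> pq mf; have intf := atomic_integrable _ mf.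
have sub : [set p; q] `<=` D by move=> x [->|->].
rewrite {1}/Rintegral (negligible_integral mN mD intf muD) setDN.
rewrite -[LHS]/(Rintegral mu [set p; q] f) Rintegral_setU//; last 2 first.
- exact: integrableS intf.
- by apply/disj_setPS => x [/= -> /pq].
by congr (_ + _); rewrite -Rintegral_cst//; apply: eq_Rintegral => x;
  rewrite inE => ->.
Qed.

End atomic_measure.

(** * Lévy measures: exponents, integrability and support *)

Section levy.
Variable R : realType.
Implicit Types (mu nu : {measure set (R * R)%type -> \bar R}) (p s : R * R).

Lemma measurable_point p : measurable [set p].
Proof.
case: p => x y; rewrite [X in measurable X](_ : _ = [set x] `*` [set y]).
  by apply: measurableX; exact: measurable_set1.
by apply/seteqP; split => [_ ->//|[u v] [/= -> ->]].
Qed.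

Lemma measurable_torus : measurable (@torus R).
Proof.
have m : measurable_fun setT (fun s : R * R => s.1 ^+ 2 + s.2 ^+ 2).
  by apply: measurable_funD; apply: measurable_funX;
    [exact: measurable_fst | exact: measurable_snd].
have := m measurableT [set 1] (measurable_set1 _).
by rewrite setTI.
Qed.

Lemma Re_levy_integrand n s :
  complex.Re (levy_integrand n s) = complex.Re (toC s ^ n) - 1.
Proof. by rewrite /levy_integrand; case: (toC s ^ n) => x y /=; ring. Qed.

Lemma Im_levy_integrand n s :
  complex.Im (levy_integrand n s) = complex.Im (toC s ^ n) - n%:~R * s.2.
Proof. by rewrite /levy_integrand; case: (toC s ^ n) => x y /=; ring. Qed.

(** Both parts go through one induction because multiplication by s mixes them. *)
Lemma measurable_toC_expn (n : nat) :
  measurable_fun setT (fun s : R * R => complex.Re (toC s ^ n%:Z)) /\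
  measurable_fun setT (fun s : R * R => complex.Im (toC s ^ n%:Z)).
Proof.
elim: n => [|n [IHr IHi]].
  by split; exact: measurable_cst.
have mulE s : toC s ^ n.+1%:Z = toC s * toC s ^ n%:Z.
  by rewrite -!exprnP exprS.
split.
- rewrite [X in measurable_fun _ X](_ : _ = (fun s : R * R =>
    s.1 * complex.Re (toC s ^ n%:Z) - s.2 * complex.Im (toC s ^ n%:Z))).
    by apply: measurable_funB; apply: measurable_funM.
  by apply/funext => s; rewrite mulE; case: (toC s ^ n%:Z).
- rewrite [X in measurable_fun _ X](_ : _ = (fun s : R * R =>
    s.1 * complex.Im (toC s ^ n%:Z) + s.2 * complex.Re (toC s ^ n%:Z))).
    by apply: measurable_funD; apply: measurable_funM.
  by apply/funext => s; rewrite mulE; case: (toC s ^ n%:Z).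
Qed.

Lemma measurable_Re_levy_integrand (n : nat) :
  measurable_fun setT (fun s : R * R => complex.Re (levy_integrand n%:Z s)).
Proof.
under eq_fun do rewrite Re_levy_integrand.
by apply: measurable_funB => //; exact: (measurable_toC_expn n).1.
Qed.

Lemma measurable_Im_levy_integrand (n : nat) :
  measurable_fun setT (fun s : R * R => complex.Im (levy_integrand n%:Z s)).
Proof.
under eq_fun do rewrite Im_levy_integrand.
apply: measurable_funB; first exact: (measurable_toC_expn n).2.
by apply: measurable_funM => //; exact: measurable_snd.
Qed.

Lemma expC_eq (z w : R[i]) : expC z = expC w ->
  complex.Re z = complex.Re w /\
  exists k : int, complex.Im z - complex.Im w = pi *+ 2 * k%:~R.
Proof.
case: z => x y; case: w => u v /=; rewrite /expC /=.
move=> [].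
rewrite !mul0r subr0 addr0 subr0 addr0 => ec es.
have exu : expR x = expR u.
  (* Squared moduli: the sum of the squares of the two coordinate equations eliminates the
     angles. *)
  have : expR x ^+ 2 = expR u ^+ 2.
    rewrite -[LHS]mulr1 -[RHS]mulr1 -{1}(cos2Dsin2 y) -(cos2Dsin2 v).
    by rewrite !mulrDr -!exprMn ec es.
  by move/eqP; rewrite eqrXn2 ?expR_ge0// => /eqP.
split; first exact: expR_inj.
have e0 : expR u != 0 by rewrite gt_eqF ?expR_gt0.
by apply: cos_sin_eq; [apply: (mulfI e0) | apply: (mulfI e0)];
  rewrite -{1}exu.
Qed.


Lemma torus_bounds s : torus s -> -1 <= s.1 <= 1.
Proof. by rewrite /torus/= => ts; apply/andP; split; nra. Qed.

Lemma levy_integrable mu (C : R) (f : R * R -> R) : is_levy mu ->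
  measurable_fun (@torus R) f ->
  (forall s, torus s -> `|f s| <= C * (1 - s.1)) ->
  mu.-integrable (@torus R) (EFin \o f).
Proof.
move=> [_ _ int1] mf fC.
apply: (le_integrable measurable_torus _ _ (integrableZl measurable_torus C int1)).
  exact/measurable_EFinP.
by move=> s ts; rewrite /= lee_fin (le_trans (fC s ts))// ler_norm.
Qed.

(** On the atom, 1 - Re s is a nonzero constant, so an infinite mass would make its integral
    infinite. *)
Lemma levy_point_fin mu p : is_levy mu -> torus p -> p.1 != 1 ->
  (mu [set p] < +oo)%E.
Proof.
move=> [_ _ int1] tp p1.
have := integrableS measurable_torus (measurable_point p) _ int1.
move=> /(_ _)/integrableP[|_]; first by move=> _ ->.
rewrite (eq_integral (cst `|(1 - p.1)%:E|%E)); last by move=> s; rewrite inE => ->.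
rewrite integral_cst; last exact: measurable_point.
have := leey (mu [set p]); rewrite le_eqVlt => /predU1P[->|//].
by rewrite gt0_muley// lte_fin normr_gt0 subr_eq0 eq_sym.
Qed.

(* On the circle, [(x - a)^2 (1 - x)] is a linear combination of the
   functions [Re s^n - 1 = T_n(x) - 1], [n = 1, 2, 3]. *)
Lemma levy_cubic mu (a : R) : is_levy mu ->
  let h := fun s : R * R => (s.1 - a) ^+ 2 * (1 - s.1) in
  mu.-integrable (@torus R) (EFin \o h) /\
  Rintegral mu (@torus R) h =
    (1 + 2 * a) / 2 * complex.Re (levy_exponent mu 2)
  - 1 / 4 * complex.Re (levy_exponent mu 3)
  - (a ^+ 2 + 2 * a + 3 / 4) * complex.Re (levy_exponent mu 1).
Proof.
move=> lmu h.
pose f (n : nat) (s : R * R) := complex.Re (levy_integrand n%:Z s).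
have f1 s : torus s -> f 1%N s = s.1 - 1.
  by move=> _; rewrite /f Re_levy_integrand expr1z.
have f2 s : torus s -> f 2%N s = 2 * s.1 ^+ 2 - 2.
  rewrite /f Re_levy_integrand -exprnP /torus/= => ts.
  have -> : s.2 * s.2 = 1 - s.1 ^+ 2 by rewrite -ts; ring.
  by ring.
have f3 s : torus s -> f 3%N s = 4 * s.1 ^+ 3 - 3 * s.1 - 1.
  rewrite /f Re_levy_integrand -exprnP !exprS /torus/= => ts.
  have : s.2 ^+ 2 = 1 - s.1 ^+ 2 by rewrite -ts; ring.
  move=> e; transitivity (s.1 ^+ 3 - 3 * s.1 * s.2 ^+ 2 - 1); first by ring.
  by rewrite e; ring.
have mf n : measurable_fun (@torus R) (f n).
  exact: measurable_funS (measurable_Re_levy_integrand n).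
have intf n : (0 < n <= 3)%N -> mu.-integrable (@torus R) (EFin \o f n).
  (* The constant 9 is dictated by n = 3: 1 - T_3(x) = (1 - x)(2x + 1)^2, and (2x + 1)^2 <= 9 on
     [-1, 1]. The gap is 4 (1 - x)^2 (x + 2), whence [h3]. *)
  move=> n3; apply: (levy_integrable mu 9) => // s ts.
  have /andP[s1 s2] := torus_bounds s ts.
  have h1 : 0 <= (1 - s.1) * (1 + s.1) by rewrite mulr_ge0//; lra.
  have h2 : 0 <= (1 - s.1) * (2 * s.1 + 1) ^+ 2.
    by rewrite mulr_ge0 ?sqr_ge0//; lra.
  have h3 : 0 <= (1 - s.1) ^+ 2 * (s.1 + 2) by rewrite mulr_ge0 ?sqr_ge0//; lra.
  case: n n3 => [|[|[|[|]]]]//= _; rewrite ler_norml; apply/andP; split;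
    rewrite ?(f1 s ts) ?(f2 s ts) ?(f3 s ts); nra.
have hE : {in @torus R, h =1 (fun s => ((1 + 2 * a) / 2 * f 2%N s - 1 / 4 * f 3%N s)
    - (a ^+ 2 + 2 * a + 3 / 4) * f 1%N s)}.
  move=> s; rewrite inE => ts; rewrite (f1 s ts) (f2 s ts) (f3 s ts) /h.
  by field.
have intZ n k : (0 < n <= 3)%N ->
    mu.-integrable (@torus R) (EFin \o (fun s => k * f n s)).
  by move=> n3; apply: integrableZl (intf n n3); exact: measurable_torus.
have mT := measurable_torus.
have intD : mu.-integrable (@torus R) (EFin \o
    (fun s => (1 + 2 * a) / 2 * f 2%N s - 1 / 4 * f 3%N s)).
  exact: (integrableB mT (intZ 2%N _ isT) (intZ 3%N _ isT)).
split.
  have intB := integrableB mT intD (intZ 1%N (a ^+ 2 + 2 * a + 3 / 4) isT).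
  apply: eq_integrable intB => //.
  by move=> s ts; rewrite /= hE.
rewrite (eq_Rintegral _ hE) RintegralB//; last exact: intZ.
rewrite RintegralB//; [|exact: intZ..].
by rewrite !RintegralZl//; exact: intf.
Qed.

(** A nonnegative function with zero integral vanishes almost everywhere. On the circle its zeros
    are the two points with Re s = a and the point 1, which carries no mass. *)
Lemma levy_cubic_atomic mu (a b : R) : is_levy mu -> a ^+ 2 + b ^+ 2 = 1 ->
  Rintegral mu (@torus R) (fun s => (s.1 - a) ^+ 2 * (1 - s.1)) = 0 ->
  mu (@torus R `\` [set (a, b); (a, - b)]) = 0%E.
Proof.
move=> lmu ab1; have [inth _] := levy_cubic mu a lmu.
set h := fun s : R * R => _ in inth * => h0.
have mT := measurable_torus.
have hge0 s : torus s -> 0 <= h s.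
  by move=> /torus_bounds s1; rewrite mulr_ge0 ?sqr_ge0//; lra.
have /(ae_eq_integral_abs mu mT (measurable_int mu inth))[N [mN N0 subN]] :
    (\int[mu]_(s in @torus R) `|(EFin \o h) s| = 0)%E.
  transitivity (\int[mu]_(s in @torus R) (h s)%:E)%E.
    by apply: eq_integral => s; rewrite inE => ts; rewrite /= ger0_norm ?hge0.
  (* Since [fine] also sends infinite values to 0, finiteness of the integral is needed to pass from
     [h0] to the extended integral. *)
  by rewrite -[LHS]fineK ?integrable_fin_num// [fine _]h0.
case: lmu => _ mu1 _.
have m1 := measurable_point (1, 0).
apply: (@subset_measure0 _ _ _ _ _ (N `|` [set (1, 0)])).
- by apply: measurableD => //; apply: measurableU; exact: measurable_point.
- exact: measurableU.
- move=> s [ts sab]; have [s1|s1] := eqVneq s.1 1.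
    right; case: s s1 ts {sab} => x y/= ->; rewrite /torus/= expr1n => y0.
    by congr pair; apply/eqP; rewrite -sqrf_eq0; apply/eqP; lra.
  left; apply: subN => /= /(_ ts) [] /eqP; rewrite mulf_eq0 sqrf_eq0.
  rewrite [1 - _ == 0]subr_eq0 [1 == _]eq_sym (negbTE s1) orbF subr_eq0 => /eqP sa.
  apply: sab; case: s sa ts {s1} => x y/= ->; rewrite /torus/= -ab1.
  move=> /addrI/eqP; rewrite eqf_sqr => /orP[]/eqP ->; by [left|right].
- exact: null_set_setU.
Qed.

(** Only the part of A inside {p, q} has mass, and it is one of finitely many unions of atoms. The
    points may coincide, as they do for phi = pi. *)
Lemma atomic_measure_eq mu nu p q :
  mu (~` [set p; q]) = 0%E -> nu (~` [set p; q]) = 0%E ->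
  mu [set p] = nu [set p] -> mu [set q] = nu [set q] ->
  forall A, measurable A -> mu A = nu A.
Proof.
move=> mu0 nu0 ep eq A mA.
have mp := measurable_point p; have mq := measurable_point q.
have mpq : measurable [set p; q] by exact: measurableU.
have epq : mu [set p; q] = nu [set p; q].
  have [->|pq] := eqVneq p q; first by rewrite setUid.
  apply: (eq_measureU mp mq ep eq); suff -> : [set p] `&` [set q] = set0.
    by rewrite !measure0.
  by rewrite -subset0 => x [/= ->] /eqP; rewrite (negbTE pq).
have restr (m : {measure set (R * R)%type -> \bar R}) :
    m (~` [set p; q]) = 0%E -> m A = m (A `&` [set p; q]).
  have {1}-> : A = (A `&` [set p; q]) `|` (A `&` ~` [set p; q]).
    by rewrite -setIUr setUv setIT.
  move=> m0; apply: measureU0.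
  - exact: measurableI.
  - by apply: measurableI => //; exact: measurableC.
  - apply: (subset_measure0 _ _ _ m0) => //; last exact: measurableC.
    by apply: measurableI => //; exact: measurableC.
rewrite (restr mu mu0) (restr nu nu0) setIUr.
have I1 (x : R * R) : A `&` [set x] = [set x] \/ A `&` [set x] = set0.
  have [Ax|Ax] := pselect (A x); [left|right].
    by apply/setIidPr => _ ->.
  by rewrite -subset0 => y [Ay] /= yx; apply: Ax; rewrite -yx.
by case: (I1 p) => ->; case: (I1 q) => ->; rewrite ?setU0 ?set0U ?measure0.
Qed.

End levy.

(** * L-uniqueness: support first, then the masses of the two atoms *)

Theorem theorem8p5 (R : realType) (phi c d : R) :
  0 < phi <= pi -> 0 <= c -> 0 <= d ->
  (cos phi = -1 \/ ~ (exists (a : int) (b : nat), cos phi = a%:~R / 2 ^+ b)) ->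
  forall rho : {measure set (R * R)%type -> \bar R},
    (forall A, measurable A ->
       rho A = (c%:E * \d_(cos phi, sin phi) A + d%:E * \d_(cos phi, (- sin phi)%R) A)%E) ->
    L_unique rho.
Proof.
move=> /andP[phi0 phipi] c0 d0 hcos rho rhoE.
set a := cos phi in hcos rhoE *; set b := sin phi in rhoE *.
have ab1 : a ^+ 2 + b ^+ 2 = 1 by exact: cos2Dsin2.
have a1 : a != 1.
  apply/eqP; rewrite /a -(cos0 R) => /cos_inj.
  rewrite !in_itv/= lexx (ltW phi0) phipi pi_ge0 => /(_ isT isT) p0.
  by rewrite p0 ltxx in phi0.
pose p := (a, b); pose q := (a, - b).
have Tp : torus p by [].
have Tq : torus q by rewrite /torus/= sqrrN.
have mT := measurable_torus R.
have mp := measurable_point R p; have mq := measurable_point R q.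
have mpq : measurable [set p; q] by exact: measurableU.
have mTC : measurable (~` @torus R) by exact: measurableC.
have mTpq : measurable (@torus R `\` [set p; q]) by exact: measurableD.
have rho0 A : measurable A -> ~ A p -> ~ A q -> rho A = 0%E.
  by move=> mA Ap Aq; rewrite rhoE// !diracE !memNset// !mule0 adde0.
have rhofin A : measurable A -> (rho A < +oo)%E.
  by move=> mA; rewrite rhoE// !diracE -!EFinM -EFinD ltry.
have rhoT : rho (@torus R `\` [set p; q]) = 0%E.
  by apply: rho0 => // -[_]; apply; [left|right].
have lrho : is_levy rho.
  split.
  - by apply: rho0 => //; exact.
  - by apply: rho0; [exact: measurable_point | |]; case=> /eqP;
      rewrite (negbTE a1).
  - apply: (atomic_integrable _ _ _ rho _ p q) => //; try exact: rhofin.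
    by apply: measurable_funB => //; exact: measurable_funS measurable_fst.
split=> // nu [lnu nurho].
have expE (n : nat) := expC_eq _ _ _ (nurho n%:Z).
have ReE (n : nat) := (expE n).1.
have nuT : nu (@torus R `\` [set p; q]) = 0%E.
  apply: levy_cubic_atomic => //.
  (* The integral of the cubic depends only on real parts of exponents, so it equals its value for
     [rho], which is 0 since [rho] lives on zeros of the cubic. *)
  have [_ ->] := levy_cubic R nu a lnu; rewrite !ReE.
  have [_ <-] := levy_cubic R rho a lrho.
  rewrite /Rintegral (negligible_integral mTpq mT _ rhoT); last first.
    exact: (levy_cubic R rho a lrho).1.
  rewrite integral0_eq//= => s [Ts sN].
  have [->|->] : [set p; q] s by apply: contrapT => sp; apply: sN.
    by rewrite subrr expr0n mul0r.
  by rewrite subrr expr0n mul0r.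
have mu0C (mu : {measure set (R * R)%type -> \bar R}) : is_levy mu ->
    mu (@torus R `\` [set p; q]) = 0%E -> mu (~` [set p; q]) = 0%E.
  move=> [muC _ _] muT.
  rewrite (_ : ~` _ = ~` @torus R `|` (@torus R `\` [set p; q])).
    exact: null_set_setU.
  apply/seteqP; split=> s.
    by move=> spq; have [Ts|Ts] := pselect (torus s); [right|left].
  by move=> [Ts [] ss|[]//]; apply: Ts; rewrite ss.
have fin (mu : {measure set (R * R)%type -> \bar R}) r : is_levy mu ->
    torus r -> r.1 != 1 -> mu [set r] = (fine (mu [set r]))%:E.
  by move=> lmu Tr r1; rewrite fineK// ge0_fin_numE// levy_point_fin.
suff [ep eq] : fine (nu [set p]) = fine (rho [set p]) /\
               fine (nu [set q]) = fine (rho [set q]).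
  apply: (atomic_measure_eq R nu rho p q); [exact: mu0C | exact: mu0C | |];
    by rewrite fin// [RHS]fin// ?ep ?eq.
have mRe (n : nat) : measurable_fun (@torus R)
    (fun s => complex.Re (levy_integrand n%:Z s)).
  exact: measurable_funS (measurable_Re_levy_integrand R n).
have mIm (n : nat) : measurable_fun (@torus R)
    (fun s => complex.Im (levy_integrand n%:Z s)).
  exact: measurable_funS (measurable_Im_levy_integrand R n).
pose Re1f (s : R * R) := complex.Re (levy_integrand 1 s).
have Re1 : Rintegral nu (@torus R) Re1f = Rintegral rho (@torus R) Re1f := ReE 1%N.
case: hcos => [aN1|ndyadic].
  have b0 : b = 0 by apply/eqP; rewrite -sqrf_eq0; apply/eqP; rewrite aN1 in ab1; lra.
  have qp : q = p by rewrite /q /p b0 oppr0.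
  have R1 (mu : {measure set (R * R)%type -> \bar R}) : is_levy mu ->
     mu (@torus R `\` [set p; q]) = 0%E ->
     Rintegral mu (@torus R) Re1f =
     - 2 * fine (mu [set p]).
    move=> lmu muT; have mu1 : mu [set (1, 0)] = 0%E by case: lmu.
    (* Here p = q, whereas the two-atom formula requires distinct points; the massless point 1
       serves as the second one. The integrand at p is a - 1 = -2. *)
    rewrite (atomic_Rintegral _ _ _ _ _ p (1, 0))//.
    - by rewrite mu1 mulr0 addr0 /Re1f Re_levy_integrand expr1z/= aN1; ring.
    - exact: measurable_point.
    - by rewrite /torus/= expr1n expr0n addr0.
    - exact: levy_point_fin.
    - by rewrite mu1.
    - apply: subset_measure0 muT => //.
        by apply: measurableD => //; apply: measurableU => //; exact: measurable_point.
      by move=> s [Ts sp]; split=> // -[] ss; apply: sp; left; rewrite ss ?qp.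
    - by case=> /eqP; rewrite (negbTE a1).
    - exact: mRe 1%N.
  rewrite !R1// in Re1; rewrite qp.
  by split; apply: (mulfI _ Re1); rewrite oppr_eq0 pnatr_eq0.
have b0 : b != 0.
  rewrite gt_eqF// sin_gt0_pi// phi0 lt_neqAle phipi andbT.
  (* phi = pi is excluded because cos pi = -1 = -1 / 2^0 is dyadic. *)
  apply/eqP => pp; apply: ndyadic; exists (-1), 0%N.
  by rewrite /a pp cospi expr0 divr1.
have pq : p <> q by case=> /eqP; rewrite -addr_eq0 -mulr2n mulrn_eq0 (negbTE b0).
have RintE (mu : {measure set (R * R)%type -> \bar R}) (f : R * R -> R) :
    is_levy mu -> mu (@torus R `\` [set p; q]) = 0%E ->
    measurable_fun (@torus R) f ->
    Rintegral mu (@torus R) f = f p * fine (mu [set p]) + f q * fine (mu [set q]).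
  by move=> lmu muT mf; rewrite (atomic_Rintegral _ _ _ _ _ p q)//;
    exact: levy_point_fin.
rewrite !(RintE _ _ _ _ (mRe 1%N))// !Re_levy_integrand !expr1z/= in Re1.
set nup := fine (nu [set p]) in Re1 *; set nuq := fine (nu [set q]) in Re1 *.
set rp := fine (rho [set p]) in Re1 *; set rq := fine (rho [set q]) in Re1 *.
(* Both atoms have the same real part, so n = 1 gives the total mass after division by a - 1. *)
have {}Re1 : nup + nuq = rp + rq.
  have a1' : a - 1 != 0 by rewrite subr_eq0.
  by apply: (mulfI a1'); rewrite !mulrDr; lra.
pose K := ((nup - nuq) - (rp - rq)) / (pi *+ 2).
have pi0 : pi *+ 2 != 0 :> R by rewrite mulrn_eq0/= gt_eqF ?pi_gt0.
have Kint (n : nat) : K * (sin (n%:R * phi) - n%:R * sin phi) \is a Num.int.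
  pose Imf (s : R * R) := complex.Im (levy_integrand n%:Z s).
  have [k kE] : exists k : int, Rintegral nu (@torus R) Imf -
      Rintegral rho (@torus R) Imf = pi *+ 2 * k%:~R := (expE n).2.
  rewrite !(RintE _ _ _ _ (mIm n))// !Im_levy_integrand in kE.
  (* Viewing q as the point of angle -phi shows that the imaginary integrand takes opposite values
     at p and q, so only differences of masses enter. *)
  have toCq : toC q = toC (cos (- phi), sin (- phi)) by rewrite cosN sinN.
  rewrite toCq !toC_cos_sin/= !mulrN !sinN in kE.
  apply/intrP; exists k; apply: (mulfI pi0); rewrite -kE /K.
  by rewrite -/nup -/nuq -/rp -/rq -/b; move: (pi *+ 2) pi0 => P P0; field.
have K0 : K = 0.
  apply: contrapT => /eqP K0.
  have /intrP[m mE] := sin_lattice_int R K phi K0 b0 Kint.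
  by apply: ndyadic; exists m, 1%N; rewrite expr1 -mE mulrC mulKf ?pnatr_eq0.
(* Equal sums and equal differences of the masses determine both. *)
move/eqP: K0; rewrite mulf_eq0 invr_eq0 (negbTE pi0) orbF => /eqP K0.
by split; lra.
Qed.
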